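(* Let $\mathbf{C}$ be a perfectly symmetric category with duality operator $B_\top$ and isomorphisms $is_a : B_\top(id_a) \to a$ ($a\in Ob_{\mathbf{C}}$), and let $E:\mathbf{C}\to\mathbf{C}$ be the endofunctor given by $E(a)=B_\top(id_a)$ on objects and $E(f) = is_b^{-1}\circ f\circ is_a$ on arrows $f:a\to b$. Then $E$ is a transformation invariant up to isomorphism: iterating $E$ transforms every commutative diagram $f = h\circ g$ in $\mathbf{C}$ (with $g:a\to c$, $h:c\to b$, $f:a\to b$) into commutative diagrams $E^n(f) = E^n(h)\circ E^n(g)$, $n=1,2,3,\dots$, and for every object $a$ one has $a\simeq E(a)\simeq E^2(a)\simeq\cdots$ in $\mathbf{C}$, and for every arrow $g$ of $\mathbf{C}$ one has $g\cong E(g)\cong E^2(g)\cong \cdots$, where $\cong$ denotes equality of arrows up to isomorphism.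
   Context: A category $\mathbf{C}$ is a perfectly symmetric category (PSC) if there exists a duality operator $B_\top : Mor_{\mathbf{C}} \to Ob_{\mathbf{C}}$ (a function from arrows to objects) such that: (i) there is a partial binary operation $*$ on the set $\widetilde{Ob}_{\mathbf{C}} \subseteq Ob_{\mathbf{C}}$ of conceptualized objects (objects of the form $B_\top(f)$) with $B_\top(g\circ f) = B_\top(g) * B_\top(f)$ whenever the composition $g\circ f$ exists in $\mathbf{C}$; (ii) for each object $a$ there is an isomorphism $is_a : B_\top(id_a) \to a$ in $\mathbf{C}$. Here $B_\top$ and the isomorphisms $is_a$ are fixed as part of the data. Two arrows $h:a\to c$ and $k:b\to d$ of $\mathbf{C}$ are equal up to isomorphism, written $h\cong k$, iff they are isomorphic as objects of the arrow category of $\mathbf{C}$, i.e. there are isomorphisms $is_1:a\to b$ and $is_2:c\to d$ in $\mathbf{C}$ with $k\circ is_1 = is_2\circ h$. $E^n$ denotes the $n$-fold composite of the endofunctor $E$ with itself. *)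

(* Defs.v *)
Set Implicit Arguments.
Unset Strict Implicit.
Unset Printing Implicit Defensive.

Declare Scope cat_scope.
Delimit Scope cat_scope with cat.
Open Scope cat_scope.

Record Category := {
  Ob :> Type;
  Hom : Ob -> Ob -> Type;
  ident : forall a, Hom a a;
  comp : forall a b c, Hom b c -> Hom a b -> Hom a c;
  comp_id_l : forall a b (f : Hom a b), comp (ident b) f = f;
  comp_id_r : forall a b (f : Hom a b), comp f (ident a) = f;
  comp_assoc : forall a b c d (h : Hom c d) (g : Hom b c) (f : Hom a b),
    comp h (comp g f) = comp (comp h g) f
}.

Arguments Hom {_} _ _.
Arguments ident {_} _.
Arguments comp {_ _ _ _} _ _.

Notation "g \o f" := (comp g f) (at level 50, left associativity) : cat_scope.

Record Iso (C : Category) (a b : C) := {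
  iso_fwd :> Hom a b;
  iso_inv : Hom b a;
  iso_inv_fwd : iso_inv \o iso_fwd = ident a;
  iso_fwd_inv : iso_fwd \o iso_inv = ident b
}.

Definition isomorphic (C : Category) (a b : C) : Prop := inhabited (Iso a b).

Notation "a ≃ b" := (isomorphic a b) (at level 70) : cat_scope.

(* Isomorphism of [h] and [k] as objects of the arrow category. *)
Definition arrow_isomorphic (C : Category) (a c b d : C)
    (h : Hom a c) (k : Hom b d) : Prop :=
  exists (is1 : Iso a b) (is2 : Iso c d), k \o is1 = is2 \o h.

Notation "h ≅ k" := (arrow_isomorphic h k) (at level 70) : cat_scope.

Record Functor (C D : Category) := {
  fobj :> C -> D;
  fmap : forall a b : C, Hom a b -> Hom (fobj a) (fobj b);
  fmap_id : forall a : C, fmap (ident a) = ident (fobj a);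
  fmap_comp : forall (a b c : C) (g : Hom b c) (f : Hom a b),
    fmap (g \o f) = fmap g \o fmap f
}.

Arguments fmap {_ _} _ {_ _} _.

Definition id_functor (C : Category) : Functor C C :=
  {| fobj := fun a => a;
     fmap := fun a b f => f;
     fmap_id := fun a => eq_refl;
     fmap_comp := fun a b c g f => eq_refl |}.

Definition comp_functor (C D E : Category)
  (G : Functor D E) (F : Functor C D) : Functor C E.
Proof.
refine {| fobj := fun a => G (F a);
          fmap := fun a b f => fmap G (fmap F f) |}.
- intro a. rewrite fmap_id. apply fmap_id.
- intros a b c g f. rewrite fmap_comp. apply fmap_comp.
Defined.

Fixpoint functor_pow (C : Category) (F : Functor C C) (n : nat) : Functor C C :=
  match n with
  | O => id_functor C
  | S n' => comp_functor F (functor_pow F n')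
  end.

Notation "F ^^ n" := (functor_pow F n) (at level 30, right associativity)
  : cat_scope.

(* A function [Mor_C -> Ob_C], the arrows of [C] being the family of its
   hom-types. *)
Definition duality_operator (C : Category) : Type :=
  forall a b : C, Hom a b -> C.

Definition conceptualized (C : Category) (B : duality_operator C) (x : C) : Prop :=
  exists (a b : C) (f : Hom a b), x = B a b f.

(* A partial binary operation on the subset [P], given by its graph:
   [star x y z] reads "[x * y] is defined and equal to [z]". *)
Definition partial_binop (X : Type) (P : X -> Prop) (star : X -> X -> X -> Prop)
    : Prop :=
  (forall x y z, star x y z -> P x /\ P y /\ P z) /\
  (forall x y z z', star x y z -> star x y z' -> z = z').

(* Perfectly symmetric category structure on [C]. *)
Record PSC (C : Category) := {
  B_top : duality_operator C;
  B_top_comp : exists star : C -> C -> C -> Prop,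
    partial_binop (conceptualized B_top) star /\
    forall (a b c : C) (g : Hom b c) (f : Hom a b),
      star (B_top g) (B_top f) (B_top (g \o f));
  B_top_iso : forall a : C, Iso (B_top (ident a)) a
}.

Arguments B_top {_} _ {_ _} _.
Arguments B_top_iso {_} _ _.

Definition psc_endofunctor (C : Category) (S : PSC C) : Functor C C.
Proof.
refine {| fobj := fun a => B_top S (ident a);
          fmap := fun a b f =>
            iso_inv (B_top_iso S b) \o f \o B_top_iso S a |}.
- intro a. rewrite comp_id_r. apply iso_inv_fwd.
- intros a b c g f. rewrite !comp_assoc.
  rewrite <- (comp_assoc (iso_inv (B_top_iso S c) \o g) (B_top_iso S b)).
  now rewrite iso_fwd_inv, comp_id_r.
Defined.

(* Main.v *)
Require Import Defs.

Set Implicit Arguments.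
Unset Strict Implicit.
Unset Printing Implicit Defensive.

(** The isomorphisms [is_a] form a natural isomorphism from [E] to the identity
    functor. Hence [E k ≅ k] for every arrow [k], in particular for
    [k = E^n g], and the claims follow since [≅] is an equivalence relation. *)

Definition iso_id (C : Category) (a : C) : Iso a a :=
  {| iso_fwd := ident a;
     iso_inv := ident a;
     iso_inv_fwd := comp_id_l (ident a);
     iso_fwd_inv := comp_id_l (ident a) |}.

Definition iso_sym (C : Category) (a b : C) (i : Iso a b) : Iso b a :=
  {| iso_fwd := iso_inv i;
     iso_inv := i;
     iso_inv_fwd := iso_fwd_inv i;
     iso_fwd_inv := iso_inv_fwd i |}.

(** Serves both inverse laws in [iso_comp], where the inner pair of a fourfold composite cancels
    first. *)
Lemma comp_cancel_mid (C : Category) (a b c d : C)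
    (h : Hom b d) (p : Hom c b) (q : Hom b c) (f : Hom a b) :
  p \o q = ident b -> (h \o p) \o (q \o f) = h \o f.
Proof.
  intro Hpq.
  now rewrite comp_assoc, <- (comp_assoc h p q), Hpq, comp_id_r.
Qed.

Definition iso_comp (C : Category) (a b c : C) (j : Iso b c) (i : Iso a b) :
  Iso a c.
Proof.
  refine {| iso_fwd := j \o i; iso_inv := iso_inv i \o iso_inv j |}.
  - rewrite comp_cancel_mid by apply iso_inv_fwd. apply iso_inv_fwd.
  - rewrite comp_cancel_mid by apply iso_fwd_inv. apply iso_fwd_inv.
Defined.

Lemma arrow_isomorphic_refl (C : Category) (a c : C) (h : Hom a c) : h ≅ h.
Proof.
  exists (iso_id a), (iso_id c). cbn.
  now rewrite comp_id_l, comp_id_r.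
Qed.

Lemma arrow_isomorphic_sym (C : Category) (a b c d : C)
    (h : Hom a c) (k : Hom b d) : h ≅ k -> k ≅ h.
Proof.
  intros [i [j H]]. exists (iso_sym i), (iso_sym j). cbn.
  (* Insert $j^{-1}\circ j$ in front of $h\circ i^{-1}$; the square [H] then turns $j\circ h$ into
     $k\circ i$, and $i$ cancels against $i^{-1}$. *)
  rewrite <- (comp_id_l (h \o iso_inv i)), <- (iso_inv_fwd j).
  rewrite comp_assoc, <- (comp_assoc (iso_inv j) j h), <- H.
  now rewrite comp_assoc, <- comp_assoc, iso_fwd_inv, comp_id_r.
Qed.

(** Pasting two commutative squares along [k] gives a commutative square. *)
Lemma arrow_isomorphic_trans (C : Category) (a b c a' b' c' : C)
    (h : Hom a a') (k : Hom b b') (l : Hom c c') : h ≅ k -> k ≅ l -> h ≅ l.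
Proof.
  intros [i [i' Hi]] [j [j' Hj]]. exists (iso_comp j i), (iso_comp j' i'). cbn.
  now rewrite comp_assoc, Hj, <- comp_assoc, Hi, comp_assoc.
Qed.

Lemma arrow_isomorphic_dom (C : Category) (a b c d : C)
    (h : Hom a c) (k : Hom b d) : h ≅ k -> a ≃ b.
Proof.
  intros [i _]. exact (inhabits i).
Qed.

(** Naturality of $is$: in $is_c\circ(is_c^{-1}\circ g\circ is_a)$ the first two factors cancel,
    leaving $g\circ is_a$. *)
Lemma psc_endofunctor_arrow_isomorphic (C : Category) (S : PSC C) (a c : C)
    (g : Hom a c) : fmap (psc_endofunctor S) g ≅ g.
Proof.
  exists (B_top_iso S a), (B_top_iso S c). cbn.
  now rewrite !comp_assoc, iso_fwd_inv, comp_id_l.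
Qed.

Lemma functor_pow_arrow_isomorphic (C : Category) (F : Functor C C) :
  (forall (a c : C) (g : Hom a c), fmap F g ≅ g) ->
  forall (n : nat) (a c : C) (g : Hom a c), fmap (F ^^ n) g ≅ g.
Proof.
  intros HF n a c g. induction n as [|n IH].
  - apply arrow_isomorphic_refl.
  (* By definition $F^{n+1}(g)=F(F^n(g))$, so [HF] is applied to the arrow $F^n(g)$ rather than to
     $g$. *)
  - exact (arrow_isomorphic_trans (HF _ _ (fmap (F ^^ n) g)) IH).
Qed.

Theorem mainTheorem3 (C : Category) (S : PSC C) :
  let E := psc_endofunctor S in
  (forall (a b c : C) (g : Hom a c) (h : Hom c b) (f : Hom a b),
     f = h \o g ->
     forall n : nat, 1 <= n ->
       fmap (E ^^ n) f = fmap (E ^^ n) h \o fmap (E ^^ n) g) /\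
  (forall (a : C) (m n : nat), (E ^^ m) a ≃ (E ^^ n) a) /\
  (forall (a c : C) (g : Hom a c) (m n : nat),
     fmap (E ^^ m) g ≅ fmap (E ^^ n) g).
Proof.
  intro E.
  assert (Harr : forall (a c : C) (g : Hom a c) (m n : nat),
             fmap (E ^^ m) g ≅ fmap (E ^^ n) g).
  { intros a c g m n.
    pose proof (functor_pow_arrow_isomorphic
                  (psc_endofunctor_arrow_isomorphic S)) as Hpow.
    (* Any two iterates are compared through $g$ itself. *)
    exact (arrow_isomorphic_trans (Hpow m _ _ g)
             (arrow_isomorphic_sym (Hpow n _ _ g))). }
  split; [|split].
  - intros a b c g h f -> n _. apply fmap_comp.
  (* Objects are reached through their identity arrows: $E^m(id_a)$ has domain $E^m(a)$, so the
     domain side of the square is the required isomorphism. *)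
  - intros a m n. exact (arrow_isomorphic_dom (Harr a a (ident a) m n)).
  - exact Harr.
Qed.
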